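(* Let $r\in\mathbb{N}$ and let $\{\eta_i\}_{i=1}^r$, with $\eta_i\in S_{m_i}$ and $m_i\ge4$, be simple permutations. Then for $2\le k\le n$ and $\tau\in S_k^{\text{av}(\eta_1,\cdots,\eta_r)}$, $$E_n^{\text{av}(\eta_1,\cdots,\eta_r)}N_n^{(k;\tau)}=\frac{(n-k+1)\,|S_{n-k+1}^{\text{av}(\eta_1,\cdots,\eta_r)}|}{|S_n^{\text{av}(\eta_1,\cdots,\eta_r)}|}.$$ Also, $$E_n^{\text{av}(\eta_1,\cdots,\eta_r)}N_n^{(k)}=\frac{(n-k+1)\,|S_{n-k+1}^{\text{av}(\eta_1,\cdots,\eta_r)}|\,|S_k^{\text{av}(\eta_1,\cdots,\eta_r)}|}{|S_n^{\text{av}(\eta_1,\cdots,\eta_r)}|}.$$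
   Context: $S_n$ is the set of permutations $\sigma=\sigma_1\cdots\sigma_n$ of $[n]=\{1,\dots,n\}$. A permutation $\sigma\in S_n$ contains $\eta\in S_m$ ($m\le n$) as a pattern if there are indices $1\le i_1<\cdots<i_m\le n$ such that for all $1\le j,k\le m$, $\sigma_{i_j}<\sigma_{i_k}$ if and only if $\eta_j<\eta_k$; otherwise $\sigma$ avoids $\eta$ (so every $\sigma\in S_n$ avoids $\eta$ if $n<m$). $S_n^{\text{av}(\eta_1,\cdots,\eta_r)}$ is the set of $\sigma\in S_n$ avoiding all of $\eta_1,\dots,\eta_r$; $P_n^{\text{av}(\eta_1,\cdots,\eta_r)}$ is the uniform probability measure on it and $E_n^{\text{av}(\eta_1,\cdots,\eta_r)}$ the corresponding expectation. A permutation $\eta\in S_m$ is simple if for all $k\in\{2,\dots,m-1\}$ and all $a\in\mathbb{N}$ with $a+k-1\le m$, the set $\{\eta_a,\dots,\eta_{a+k-1}\}$ is not equal to a block of $k$ consecutive numbers in $[m]$. For $2\le k\le n$, $\tau\in S_k^{\text{av}(\eta_1,\cdots,\eta_r)}$ and $\sigma\in S_n^{\text{av}(\eta_1,\cdots,\eta_r)}$, $N_n^{(k;\tau)}(\sigma)$ is the number of occurrences of $k$ consecutive numbers appearing in $k$ consecutive positions of $\sigma$ in the order given by $\tau$, i.e. the number of pairs $(l,m)$ with $1\le l,m\le n-k+1$ such that $\{l,\dots,l+k-1\}=\{\sigma_m,\dots,\sigma_{m+k-1}\}$ and $\tau_i=\sigma_{m+i-1}-(l-1)$ for $i=1,\dots,k$.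 $N_n^{(k)}(\sigma)$ is the number of occurrences of $k$ consecutive numbers appearing in $k$ consecutive positions in $\sigma$, without regard to the order of appearance (i.e. the number of pairs $(l,m)$ with $\{l,\dots,l+k-1\}=\{\sigma_m,\dots,\sigma_{m+k-1}\}$). *)

(* Defs.v *)
From mathcomp Require Import all_boot all_order all_algebra all_fingroup.

Set Implicit Arguments.
Unset Strict Implicit.
Unset Printing Implicit Defensive.

Import GRing.Theory.
Local Open Scope ring_scope.

(* Permutations of [n] are elements of 'S_n, so positions and values are       *)
(* numbered from 0: the classical sigma_j is (sigma (j - 1)) + 1.              *)

Definition window (n a k : nat) : {set 'I_n} :=
  [set i : 'I_n | (a <= i < a + k)%N].

(* f is the index sequence i_1 < ... < i_m of an occurrence of eta in sigma.   *)
(* There is none when n < m, hence sigma then avoids eta.                      *)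
Definition contains (n m : nat) (sigma : 'S_n) (eta : 'S_m) : bool :=
  [exists f : {ffun 'I_m -> 'I_n},
    [forall j : 'I_m, forall k : 'I_m, (j < k)%N ==> (f j < f k)%N] &&
    [forall j : 'I_m, forall k : 'I_m,
       (sigma (f j) < sigma (f k))%N == (eta j < eta k)%N]].

Definition avoids (n m : nat) (sigma : 'S_n) (eta : 'S_m) : bool :=
  ~~ contains sigma eta.

Definition Sav (r : nat) (m : 'I_r -> nat) (eta : forall i, 'S_(m i)) (n : nat)
  : {set 'S_n} :=
  [set sigma : 'S_n | [forall i : 'I_r, avoids sigma (eta i)]].

(* The bounds a + k <= m and b + k <= m keep both windows inside [m], so that  *)
(* each of them has exactly k elements.                                        *)
Definition simple_perm (m : nat) (eta : 'S_m) : Prop :=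
  forall k a b : nat, (2 <= k <= m.-1)%N -> (a + k <= m)%N -> (b + k <= m)%N ->
    [set eta i | i in window m a k] <> window m b k.

Definition is_cluster (n k : nat) (sigma : 'S_n) (l p : nat) : bool :=
  [set sigma i | i in window n p k] == window n l k.

(* The equation is tau_i = sigma_(p+i) - l, written without truncated          *)
(* subtraction; j is the position p + i.                                       *)
Definition has_order (n k : nat) (tau : 'S_k) (sigma : 'S_n) (l p : nat)
  : bool :=
  [forall i : 'I_k, forall j : 'I_n,
    (j == p + i :> nat)%N ==> (sigma j == l + tau i :> nat)%N].

(* A pair lp is a starting value and a starting position; the index type       *)
(* 'I_(n - k + 1) and hence both counts are meant for k <= n only.             *)
Definition Ntau (n k : nat) (tau : 'S_k) (sigma : 'S_n) : nat :=
  #|[set lp : 'I_(n - k + 1) * 'I_(n - k + 1) |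
      is_cluster k sigma lp.1 lp.2 && has_order tau sigma lp.1 lp.2]|.

Definition Ncluster (n k : nat) (sigma : 'S_n) : nat :=
  #|[set lp : 'I_(n - k + 1) * 'I_(n - k + 1) |
      is_cluster k sigma lp.1 lp.2]|.

(* Probabilities and expectations on a finite set of outcomes are rational.    *)
Definition uniform_prob (T : finType) (A B : {set T}) : rat :=
  #|A :&: B|%:R / #|A|%:R.

Definition uniform_expect (T : finType) (A : {set T}) (X : T -> rat) : rat :=
  \sum_(s in A) X s * uniform_prob A [set s].

Definition Eav (r : nat) (m : 'I_r -> nat) (eta : forall i, 'S_(m i)) (n : nat)
  : ('S_n -> rat) -> rat := uniform_expect (Sav eta n).

(* Main.v *)
Require Import Defs.
From mathcomp Require Import all_boot all_order all_algebra all_fingroup.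
From mathcomp Require Import zify.

Set Implicit Arguments.
Unset Strict Implicit.
Unset Printing Implicit Defensive.

Import GRing.Theory.
Local Open Scope ring_scope.

(** Collapsing a cluster is a bijection. Fix a starting value [l] and a starting
    position [p], and put N = n - k + 1. A permutation [sigma] of size [n]
    having a [k]-cluster at [(l, p)] in the order [tau] is the same thing as a
    permutation [rho] of size [N] with [rho p = l]: shrink the [k] positions and
    the [k] values of the cluster to a single point, or conversely inflate the
    point [(p, l)] of [rho] by a copy of [tau]. The relation [is_inflation]
    expresses this correspondence symmetrically, and it is functional and total
    in both directions.

    Simplicity enters through avoidance: if [tau] avoids the patterns, then
    [sigma] avoids them exactly when [rho] does ([Sav_inflation]). Indeed [rho]
    is a pattern of [sigma]. Conversely, take an occurrence of a simple [eta] in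
    [sigma] ([contains_inflation]). The entries of [eta] that fall in the
    cluster occupy an interval of positions and an interval of values, so by
    simplicity there are at most one of them, in which case the occurrence
    survives in [rho], or all of them, in which case it lies within [tau].

    Hence, for fixed [(l, p)], the avoiding [sigma] with such a cluster are as
    many as the avoiding [rho] with [rho p = l] ([card_Sav_order]). Summing over
    [l] lifts the constraint on [rho], and summing over the [N] positions [p]
    gives N * |Sav N| for the total number of clusters of order [tau]. The
    second formula follows because each cluster of an avoiding permutation has
    exactly one order, which is itself avoiding ([card_clusters]). *)

(** * Counting tools *)

(** A relation that is total and functional in both directions is the graph of
    a bijection; this form avoids naming the two inverse maps, each of which is
    defined only on permutations with the required cluster or value. *)
Lemma card_eq_rel (T U : finType) (A : {set T}) (B : {set U})
    (R : T -> U -> bool) :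
  (forall x, x \in A -> exists2 y, y \in B & R x y) ->
  (forall y, y \in B -> exists2 x, x \in A & R x y) ->
  (forall x y y', R x y -> R x y' -> y = y') ->
  (forall x x' y, R x y -> R x' y -> x = x') ->
  #|A| = #|B|.
Proof.
move=> totA totB funR injR; rewrite -!sum1_card.
transitivity (\sum_(x in A) \sum_(y in B) R x y)%N.
  apply: eq_bigr => x /totA[y yB Rxy].
  rewrite (bigD1 y) //= Rxy big1 // => z /andP[_ /eqP zy].
  by case: (boolP (R x z)) => // /funR/(_ Rxy).
rewrite exchange_big; apply: eq_bigr => y /totB[x xA Rxy].
rewrite (bigD1 x) //= Rxy big1 // => z /andP[_ /eqP zx].
by case: (boolP (R z y)) => // /injR/(_ Rxy).
Qed.

Lemma card_set_sum (T : finType) (P : pred T) :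
  #|[set x | P x]| = (\sum_x P x)%N.
Proof.
by rewrite -sum1dep_card big_mkcond; apply: eq_bigr => x _; case: (P x).
Qed.

(** * Windows and patterns *)

Lemma in_window n a k (i : 'I_n) : (i \in window n a k) = (a <= i < a + k)%N.
Proof. by rewrite inE. Qed.

Lemma windowP n a k (j : 'I_n) :
  reflect (exists i : 'I_k, j = (a + i)%N :> nat) (j \in window n a k).
Proof.
rewrite in_window; apply: (iffP idP) => [ja | [i ->]].
  by have lt_k : (j - a < k)%N by [lia]; exists (Ordinal lt_k) => /=; lia.
by have := ltn_ord i; lia.
Qed.

Lemma card_window n a k : (a + k <= n)%N -> #|window n a k| = k.
Proof.
move=> le_n; pose f (i : 'I_k) := widen_ord le_n (rshift a i).
have f_inj : injective f.
  by move=> i i' /(congr1 val) /= /eqP; rewrite eqn_add2l => /eqP/val_inj.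
rewrite -[RHS]card_ord -(card_imset _ f_inj); congr #|pred_of_set _|.
apply/setP=> j; rewrite in_window; apply/idP/imsetP => [ja | [i _ ->]].
  have lt_k : (j - a < k)%N by lia.
  by exists (Ordinal lt_k) => //; apply: val_inj => /=; lia.
by have := ltn_ord i; rewrite /=; lia.
Qed.

(** Bridges occurrences and [simple_perm]: the positions, and the values, of
    an occurrence that meet a cluster are only seen to be convex, whereas
    simplicity speaks of windows with explicit bounds. *)
Lemma convex_window n (W : {set 'I_n}) i0 :
  i0 \in W ->
  (forall i j k : 'I_n, i \in W -> k \in W -> (i <= j <= k)%N -> j \in W) ->
  exists2 a, (a + #|W| <= n)%N & W = window n a #|W|.
Proof.
move=> i0W convW.
case: (arg_minnP (fun i : 'I_n => val i) i0W) => a aW minW.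
case: (arg_maxnP (fun i : 'I_n => val i) i0W) => b bW maxW.
have defW : W = window n a (b - a).+1.
  apply/setP=> j; rewrite in_window; apply/idP/idP => [jW | jab].
    by have := minW j jW; have := maxW j jW; rewrite /=; lia.
  by apply: (convW a j b) => //; have := minW b bW; rewrite /=; lia.
have le_n : (a + (b - a).+1 <= n)%N.
  by have := ltn_ord b; have := minW b bW; rewrite /=; lia.
have cardW : #|W| = (b - a).+1 by rewrite defW card_window.
by exists a; rewrite cardW.
Qed.

(** * Collapsing a window to a point *)

(** The weakly increasing map of nat that sends the whole window [a, a + k) to
    [a] and is injective elsewhere: [x] below the window is kept, and [x]
    beyond it is lowered by [k - 1]. *)
Definition collapse (k a x : nat) : nat := (minn x a + (x - (a + k.-1)))%N.

Lemma collapse_inj_or k a x y : collapse k a x = collapse k a y ->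
  x = y \/ (a <= x < a + k)%N /\ (a <= y < a + k)%N.
Proof. rewrite /collapse; lia. Qed.

Lemma ltn_collapse k a x y : collapse k a x <> collapse k a y ->
  (collapse k a x < collapse k a y)%N = (x < y)%N.
Proof. rewrite /collapse; lia. Qed.

(** When [N + k = n.+1] the collapse always lands below [N] (see [val_col]), so
    the default of [insubd] never comes into play; it makes the map total
    without a proof in its arguments. *)
Definition col (n N k : nat) (a : 'I_N) (j : 'I_n) : 'I_N :=
  insubd a (collapse k a j).

(** [sigma] arises from [rho] by replacing its point [(p, l)] by a copy of
    [tau]: outside of the cluster the two permutations agree after collapsing
    the positions around [p] and the values around [l]. *)
Definition is_inflation (n N k : nat) (tau : 'S_k) (l p : 'I_N) (sigma : 'S_n)
    (rho : 'S_N) : bool :=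
  has_order tau sigma l p && [forall j, rho (col k p j) == col k l (sigma j)].

Lemma containsP n m (sigma : 'S_n) (eta : 'S_m) :
  reflect (exists f : 'I_m -> 'I_n,
             {homo f : j k / (j < k)%N} /\
             forall j k, (sigma (f j) < sigma (f k))%N = (eta j < eta k)%N)
          (contains sigma eta).
Proof.
apply: (iffP existsP) => [[f /andP[/forallP fh /forallP fo]] | [f [fh fo]]].
  exists f; split=> j k; first by have /forallP/(_ k)/implyP := fh j.
  by have /forallP/(_ k)/eqP := fo j.
exists (finfun f); apply/andP; split; apply/forallP=> j; apply/forallP=> k.
  by rewrite !ffunE; apply/implyP/fh.
by rewrite !ffunE fo.
Qed.

Lemma has_orderP n k (tau : 'S_k) (sigma : 'S_n) (l p : nat) :
  reflect (forall (i : 'I_k) (j : 'I_n),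
             j = (p + i)%N :> nat -> sigma j = (l + tau i)%N :> nat)
          (has_order tau sigma l p).
Proof.
apply: (iffP forallP) => [ord i j /eqP ji | ord i].
  by have /forallP/(_ j)/implyP/(_ ji)/eqP := ord i.
by apply/forallP=> j; apply/implyP=> /eqP/ord/eqP.
Qed.

Lemma cluster_window n k (sigma : 'S_n) (l p : nat) (j : 'I_n) :
  is_cluster k sigma l p ->
  (sigma j \in window n l k) = (j \in window n p k).
Proof. by move=> /eqP <-; rewrite mem_imset //; apply: perm_inj. Qed.

(** * Inflation as a one-to-one correspondence *)

Section Collapse.

Variables n N k : nat.
Hypotheses (k_gt0 : (0 < k)%N) (sizeE : (N + k = n.+1)%N).

Implicit Types (a l p : 'I_N) (sigma : 'S_n) (rho : 'S_N) (tau : 'S_k).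

Lemma window_fits a : (a + k <= n)%N.
Proof. by have := ltn_ord a; lia. Qed.

Lemma val_col a (j : 'I_n) : col k a j = collapse k a j :> nat.
Proof.
rewrite /col val_insubd ifT //.
by have := ltn_ord a; have := ltn_ord j; rewrite /collapse; lia.
Qed.

Lemma col_inj_or a (i j : 'I_n) : col k a i = col k a j ->
  i = j \/ i \in window n a k /\ j \in window n a k.
Proof.
move=> /(congr1 val) /=; rewrite !val_col !in_window => /collapse_inj_or.
by case=> [/val_inj|]; [left | right].
Qed.

Lemma col_eq_center a (j : 'I_n) : (col k a j == a) = (j \in window n a k).
Proof. by rewrite -val_eqE /= val_col in_window /collapse; lia. Qed.

Lemma col_surj a (i : 'I_N) : exists j : 'I_n, col k a j == i.
Proof.
have lt_n : (i + (a < i) * k.-1 < n)%N by have := ltn_ord i; lia.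
exists (Ordinal lt_n); rewrite -val_eqE /= val_col /collapse /=; lia.
Qed.

Lemma ltn_col a (i j : 'I_n) : col k a i <> col k a j ->
  (col k a i < col k a j)%N = (i < j)%N.
Proof.
rewrite !val_col => neq; apply: ltn_collapse => eq; apply: neq.
by apply: val_inj; rewrite /= !val_col.
Qed.

Lemma has_order_cluster tau sigma l p :
  has_order tau sigma l p -> is_cluster k sigma l p.
Proof.
move=> /has_orderP ord; rewrite /is_cluster eqEcard.
rewrite card_imset; last exact: perm_inj.
rewrite !card_window ?window_fits // leqnn andbT.
apply/subsetP=> _ /imsetP[j /windowP[i ji] ->].
by rewrite in_window (ord i j ji); have := ltn_ord (tau i); lia.
Qed.

Lemma inflation_col tau l p sigma rho (j : 'I_n) :
  is_inflation tau l p sigma rho -> rho (col k p j) = col k l (sigma j).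
Proof. by case/andP=> _ /forallP/(_ j)/eqP. Qed.

Lemma inflation_order tau l p sigma rho :
  is_inflation tau l p sigma rho -> has_order tau sigma l p.
Proof. by case/andP. Qed.

Lemma inflation_window tau l p sigma rho (j : 'I_n) :
  is_inflation tau l p sigma rho ->
  (sigma j \in window n l k) = (j \in window n p k).
Proof. by move=> /inflation_order/has_order_cluster/cluster_window. Qed.

Lemma inflation_inj_rho tau l p sigma rho rho' :
  is_inflation tau l p sigma rho -> is_inflation tau l p sigma rho' ->
  rho = rho'.
Proof.
move=> infl infl'; apply/permP=> i; have [j /eqP <-] := col_surj p i.
by rewrite (inflation_col _ infl) (inflation_col _ infl').
Qed.

(** Outside of the cluster the value of [sigma] is recovered from its collapse;
    inside, it is dictated by [tau]. *)
Lemma inflation_inj_sigma tau l p sigma sigma' rho :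
  is_inflation tau l p sigma rho -> is_inflation tau l p sigma' rho ->
  sigma = sigma'.
Proof.
move=> infl infl'; apply/permP=> j.
have: col k l (sigma j) = col k l (sigma' j).
  by rewrite -(inflation_col _ infl) -(inflation_col _ infl').
case/col_inj_or=> // -[+ _].
rewrite (inflation_window _ infl) => /windowP[i ji].
have /has_orderP/(_ i j ji) s1 := inflation_order infl.
have /has_orderP/(_ i j ji) s2 := inflation_order infl'.
by apply: val_inj; rewrite /= s1 s2.
Qed.

(** Any section [q] of the collapse of positions serves to read [rho] off
    [sigma]: within the cluster all choices give the same collapsed value. *)
Lemma deflation_exists tau l p sigma :
  has_order tau sigma l p ->
  exists2 rho : 'S_N, rho p = l & is_inflation tau l p sigma rho.
Proof.
move=> ord; have clus := has_order_cluster ord.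
pose q i := xchoose (col_surj p i).
have qK i : col k p (q i) = i by apply/eqP/(xchooseP (col_surj p i)).
have colE i j : col k p i = col k p j ->
    col k l (sigma i) = col k l (sigma j).
  case/col_inj_or=> [-> // | [iW jW]].
  apply/eqP; rewrite (eqP (_ : col k l (sigma j) == l)) ?col_eq_center;
    by rewrite (cluster_window _ clus).
have rho_inj : injective (fun i => col k l (sigma (q i))).
  move=> i j /col_inj_or[/perm_inj eq_q | []].
    by rewrite -[i]qK -[j]qK eq_q.
  rewrite !(cluster_window _ clus) -!col_eq_center !qK.
  by move=> /eqP-> /eqP->.
exists (perm rho_inj).
  rewrite permE; apply/eqP.
  by rewrite col_eq_center (cluster_window _ clus) -col_eq_center qK.
apply/andP; split=> //; apply/forallP=> j; rewrite permE; apply/eqP.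
by apply: colE; rewrite qK.
Qed.

(** The values are chosen position by position from their two defining
    equations, which already force injectivity: equal values have equal
    collapses, so two distinct positions sharing a value would both lie in the
    cluster, where [tau] separates them. *)
Lemma inflation_exists tau l p rho :
  rho p = l -> exists sigma, is_inflation tau l p sigma rho.
Proof.
move=> rhop.
have /fin_all_exists[s sP] (j : 'I_n) : exists v : 'I_n,
    col k l v = rho (col k p j) /\
    forall i : 'I_k, j = (p + i)%N :> nat -> v = (l + tau i)%N :> nat.
  have [jW|njW] := boolP (j \in window n p k).
    have /windowP[i ji] := jW.
    have lt_n : (l + tau i < n)%N.
      by have := window_fits l; have := ltn_ord (tau i); lia.
    exists (Ordinal lt_n); split.
      move: jW; rewrite -col_eq_center => /eqP->; rewrite rhop.
      apply/eqP; rewrite col_eq_center in_window /=.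
      by have := ltn_ord (tau i); lia.
    by move=> i'; rewrite ji => /eqP; rewrite eqn_add2l => /eqP/val_inj <-.
  have [v /eqP <-] := col_surj l (rho (col k p j)).
  exists v; split=> // i ji; case/negP: njW.
  by apply/windowP; exists i.
have s_inj : injective s.
  move=> j j' eq_s; have [e o] := sP j; have [e' o'] := sP j'.
  have /perm_inj/col_inj_or[// | []] : rho (col k p j) = rho (col k p j').
    by rewrite -e -e' eq_s.
  move=> /windowP[i ji] /windowP[i' ji'].
  have := o i ji; rewrite eq_s (o' i' ji') => /eqP.
  rewrite eqn_add2l => /eqP/val_inj/perm_inj eq_i.
  by apply: val_inj; rewrite /= ji ji' eq_i.
exists (perm s_inj); apply/andP; split.
  by apply/has_orderP=> i j; rewrite permE; apply: (sP j).2.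
by apply/forallP=> j; rewrite permE (sP j).1.
Qed.

(** * Patterns under inflation *)

Lemma contains_deflation m (eta : 'S_m) tau l p sigma rho :
  is_inflation tau l p sigma rho -> contains rho eta -> contains sigma eta.
Proof.
move=> infl /containsP[f [f_homo f_eta]]; apply/containsP.
pose q i := xchoose (col_surj p i).
have qK i : col k p (q i) = i by apply/eqP/(xchooseP (col_surj p i)).
exists (q \o f); split=> [i j ij | i j] /=.
  have f_ij := f_homo i j ij.
  rewrite -(@ltn_col p) !qK // => eq_f.
  by move: f_ij; rewrite eq_f ltnn.
rewrite -f_eta; have [-> | neq_f] := eqVneq (f i) (f j); first by rewrite !ltnn.
rewrite -(@ltn_col l) -!(inflation_col _ infl) !qK //.
by move=> /perm_inj/eqP; apply/negP.
Qed.

Lemma contains_order m (eta : 'S_m) tau sigma l p :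
  has_order tau sigma l p -> contains tau eta -> contains sigma eta.
Proof.
move=> /has_orderP ord /containsP[f [f_homo f_eta]]; apply/containsP.
have shift_lt (i : 'I_k) : (p + i < n)%N.
  by have := window_fits p; have := ltn_ord i; lia.
exists (fun j => Ordinal (shift_lt (f j))); split=> [i j ij | i j] /=.
  by rewrite ltn_add2l f_homo.
by rewrite (ord (f i)) // (ord (f j)) // ltn_add2l.
Qed.

(** The heart of the argument. The part of an occurrence of [eta] inside the
    cluster is an interval both in position and in value, so simplicity leaves
    only two cases: it is too small to be affected by collapsing the cluster, or
    it is the whole occurrence. *)
Lemma contains_inflation m (eta : 'S_m) tau l p sigma rho :
  simple_perm eta -> is_inflation tau l p sigma rho -> contains sigma eta ->
  contains rho eta \/ contains tau eta.
Proof.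
move=> simple_eta infl /containsP[f [f_homo f_eta]].
have ord := inflation_order infl.
have f_le (i j : 'I_m) : (i <= j)%N -> (f i <= f j)%N.
  by rewrite leq_eqVlt => /orP[/eqP/val_inj-> // | /f_homo/ltnW].
have se_le (i j : 'I_m) : (eta i <= eta j)%N -> (sigma (f i) <= sigma (f j))%N.
  by rewrite leqNgt -f_eta -leqNgt.
pose W := [set j | f j \in window n p k].
have inW j : (j \in W) = (f j \in window n p k) by rewrite inE.
have inW_val j : (j \in W) = (sigma (f j) \in window n l k).
  by rewrite inW (inflation_window _ infl).
have [W_le1 | W_gt1] := leqP #|W| 1.
  (* Collapsing identifies only points of the cluster, so it keeps the
     occurrence strictly ordered when at most one of its points is there. *)
  left; apply/containsP; exists (col k p \o f).
  have eqW i j : i \in W -> j \in W -> i = j.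
    by move=> iW jW; exact: (card_le1_eqP W_le1).
  split=> [i j ij | i j] /=.
    rewrite ltn_col ?f_homo // => /col_inj_or[eq_f | ].
      by have := f_homo i j ij; rewrite eq_f ltnn.
    by rewrite -!inW => -[iW jW]; move: ij; rewrite (eqW i j) // ltnn.
  rewrite -f_eta !(inflation_col _ infl).
  have [-> | /eqP neq] := eqVneq i j; first by rewrite !ltnn.
  rewrite ltn_col // => /col_inj_or[/perm_inj eq_f|].
    by case: (ltngtP i j) => [/f_homo | /f_homo | /val_inj //];
      rewrite eq_f ltnn.
  by rewrite -!inW_val => -[iW jW]; apply: neq; apply: eqW.
have [i0 i0W] : exists i0, i0 \in W by apply/card_gt0P; lia.
(* Now 2 <= #|W|; if W is not everything then W and its image under eta are
   two windows of the same proper size, which simplicity forbids. *)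
have [W_ltm | W_gem] := ltnP #|W| m.
  have [a a_le defW] : exists2 a, (a + #|W| <= m)%N & W = window m a #|W|.
    apply: convex_window i0W _ => i j i' /[!inW] /[!in_window] iW iW'.
    by case/andP=> /f_le ? /f_le ?; lia.
  have card_eW : #|[set eta i | i in W]| = #|W|.
    by apply: card_imset; apply: perm_inj.
  have [b b_le def_eW] : exists2 b, (b + #|W| <= m)%N &
      [set eta i | i in W] = window m b #|W|.
    rewrite -card_eW; apply: (convex_window (imset_f _ i0W)).
    move=> _ v _ /imsetP[i + ->] /imsetP[i' + ->].
    rewrite !inW_val !in_window -[v](permKV eta) => iW iW'.
    case/andP=> /se_le ? /se_le ?; apply: imset_f.
    by rewrite inW_val in_window; lia.
  case: (simple_eta #|W| a b) => //; first by lia.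
  by rewrite -defW.
right; apply/containsP.
have W_full j : j \in W.
  have -> // : W = setT.
  by apply/eqP; rewrite eqEcard subsetT cardsT card_ord.
have /fin_all_exists[g gP] (j : 'I_m) : exists i : 'I_k, f j = (p + i)%N :> nat.
  by apply/windowP; rewrite -inW.
have /has_orderP ordP := ord.
exists g; split=> [i j /f_homo | i j].
  by rewrite !gP ltn_add2l.
by rewrite -f_eta (ordP _ _ (gP i)) (ordP _ _ (gP j)) ltn_add2l.
Qed.

(** * Counting clusters *)

Lemma has_order_inj tau tau' sigma l p :
  has_order tau sigma l p -> has_order tau' sigma l p -> tau = tau'.
Proof.
move=> /has_orderP ord /has_orderP ord'; apply/permP=> i; apply: val_inj => /=.
have lt_n : (p + i < n)%N by have := window_fits p; have := ltn_ord i; lia.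
apply/eqP; rewrite -(eqn_add2l l) -(ord i (Ordinal lt_n)) //.
by rewrite -(ord' i (Ordinal lt_n)).
Qed.

Lemma cluster_has_order sigma l p :
  is_cluster k sigma l p -> exists tau, has_order tau sigma l p.
Proof.
move=> clus.
have lt_n (i : 'I_k) : (p + i < n)%N.
  by have := window_fits p; have := ltn_ord i; lia.
have /fin_all_exists[t tP] (i : 'I_k) : exists v : 'I_k,
    sigma (Ordinal (lt_n i)) = (l + v)%N :> nat.
  by apply/windowP; rewrite (cluster_window _ clus); apply/windowP; exists i.
have t_inj : injective t.
  move=> i i' eq_t; apply/val_inj/eqP; rewrite -(eqn_add2l p) /=.
  have /perm_inj/(congr1 val) /= -> // :
    sigma (Ordinal (lt_n i)) = sigma (Ordinal (lt_n i')).
  by apply: val_inj; rewrite /= !tP eq_t.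
exists (perm t_inj); apply/has_orderP=> i j ji; rewrite permE -tP.
by congr (val (sigma _)); apply: val_inj.
Qed.

Section Avoidance.

Variables (r : nat) (m : 'I_r -> nat) (eta : forall i, 'S_(m i)).
Hypothesis simple_eta : forall i, simple_perm (eta i).

Lemma SavP j (sigma : 'S_j) :
  reflect (forall i, ~ contains sigma (eta i)) (sigma \in Sav eta j).
Proof. by rewrite inE; apply: (iffP forallP) => av i; apply/negP/av. Qed.

Lemma Sav_inflation tau l p sigma rho :
  tau \in Sav eta k -> is_inflation tau l p sigma rho ->
  (sigma \in Sav eta n) = (rho \in Sav eta N).
Proof.
move=> /SavP tau_av infl; apply/SavP/SavP => av i con; apply: (av i).
  exact: contains_deflation infl con.
by have [//|/tau_av] := contains_inflation (@simple_eta i) infl con.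
Qed.

Lemma Sav_order tau l p sigma :
  sigma \in Sav eta n -> has_order tau sigma l p -> tau \in Sav eta k.
Proof.
by move=> /SavP av ord; apply/SavP=> i con; apply/(av i)/(contains_order ord).
Qed.

(** For a fixed place of the cluster; this is the correspondence restricted to
    the avoiding permutations. *)
Lemma card_Sav_order tau l p : tau \in Sav eta k ->
  #|[set sigma in Sav eta n | has_order tau sigma l p]| =
  #|[set rho in Sav eta N | rho p == l]|.
Proof.
move=> tau_av; apply: (@card_eq_rel _ _ _ _ (is_inflation tau l p)).
- move=> sigma /setIdP[sigma_av /deflation_exists[rho rhop infl]].
  exists rho => //; rewrite inE rhop eqxx andbT.
  by rewrite -(Sav_inflation tau_av infl).
- move=> rho /setIdP[rho_av /eqP/(inflation_exists tau)[sigma infl]].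
  exists sigma => //; rewrite inE (inflation_order infl) andbT.
  by rewrite (Sav_inflation tau_av infl).
- by move=> *; apply: inflation_inj_rho; eassumption.
- by move=> *; apply: inflation_inj_sigma; eassumption.
Qed.

(** Once [p] is fixed, the conditions [rho p = l] for varying [l] partition the
    avoiding [rho], so that each of the [N] positions contributes all of
    them. *)
Lemma sum_ordered_clusters tau : tau \in Sav eta k ->
  (\sum_(sigma in Sav eta n) #|[set lp : 'I_N * 'I_N |
      is_cluster k sigma lp.1 lp.2 && has_order tau sigma lp.1 lp.2]|
   = N * #|Sav eta N|)%N.
Proof.
move=> tau_av.
transitivity (\sum_(l < N) \sum_(p < N)
                 #|[set rho in Sav eta N | rho p == l]|)%N.
  rewrite pair_bigA /=.
  under eq_bigr do rewrite card_set_sum.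
  rewrite exchange_big; apply: eq_bigr => -[l p] _ /=.
  rewrite -(card_Sav_order l p tau_av) -sum1dep_card big_mkcondr /=.
  apply: eq_bigr => sigma _; case ord: has_order; last by rewrite andbF.
  by rewrite (has_order_cluster ord).
rewrite exchange_big -[X in (X * _)%N](card_ord N) -sum_nat_const /=.
apply: eq_bigr => p _.
rewrite -sum1_card (partition_big (fun rho : 'S_N => rho p) predT) //=.
by apply: eq_bigr => l _; rewrite -sum1dep_card.
Qed.

(** The order of a cluster of [sigma] is a pattern of [sigma], so it is enough
    to sum over the avoiding [tau]. *)
Lemma card_clusters sigma : sigma \in Sav eta n ->
  (#|[set lp : 'I_N * 'I_N | is_cluster k sigma lp.1 lp.2]| =
   \sum_(tau in Sav eta k) #|[set lp : 'I_N * 'I_N |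
      is_cluster k sigma lp.1 lp.2 && has_order tau sigma lp.1 lp.2]|)%N.
Proof.
move=> sigma_av; rewrite card_set_sum.
under [RHS]eq_bigr do rewrite card_set_sum.
rewrite exchange_big; apply: eq_bigr => -[l p] _ /=.
have [clus | _] := boolP (is_cluster _ _ _ _); last by rewrite big1.
have [tau ord] := cluster_has_order clus.
rewrite (bigD1 tau) ?(Sav_order sigma_av ord) //= ord big1 // => tau'.
case/andP=> _ /eqP neq; case: (boolP (has_order tau' _ _ _)) => // ord'.
by case: neq; apply: has_order_inj ord' ord.
Qed.

Lemma sum_clusters :
  (\sum_(sigma in Sav eta n) #|[set lp : 'I_N * 'I_N |
      is_cluster k sigma lp.1 lp.2]|
   = N * #|Sav eta N| * #|Sav eta k|)%N.
Proof.
under eq_bigr => sigma sigma_av do rewrite card_clusters //.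
rewrite exchange_big /= mulnC -sum_nat_const.
by apply: eq_bigr => tau; apply: sum_ordered_clusters.
Qed.

End Avoidance.

End Collapse.

(** * The expectations *)

Lemma uniform_expect_nat (T : finType) (A : {set T}) (X : T -> nat) :
  uniform_expect A (fun s => (X s)%:R) =
    (\sum_(s in A) X s)%N%:R / #|A|%:R :> rat.
Proof.
rewrite natr_sum mulr_suml; apply: eq_bigr => s sA.
by rewrite /uniform_prob (setIidPr _) ?sub1set // cards1 mul1r.
Qed.

Theorem theorem3 (r : nat) (m : 'I_r -> nat) (eta : forall i : 'I_r, 'S_(m i))
    (hr : (1 <= r)%N)
    (hm : forall i : 'I_r, (4 <= m i)%N)
    (hsimple : forall i : 'I_r, simple_perm (eta i))
    (n k : nat) (hk : (2 <= k <= n)%N) :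
  (forall tau : 'S_k, tau \in Sav eta k ->
     Eav eta (fun sigma : 'S_n => (Ntau tau sigma)%:R) =
       ((n - k + 1)%N%:R * #|Sav eta (n - k + 1)|%:R) / #|Sav eta n|%:R)
  /\
  Eav eta (fun sigma : 'S_n => (Ncluster k sigma)%:R) =
    ((n - k + 1)%N%:R * #|Sav eta (n - k + 1)|%:R * #|Sav eta k|%:R)
      / #|Sav eta n|%:R.
Proof.
have k_gt0 : (0 < k)%N by lia.
have sizeE : (n - k + 1 + k)%N = n.+1 by lia.
split=> [tau tau_av|]; rewrite /Eav uniform_expect_nat -!natrM.
  by rewrite -(sum_ordered_clusters k_gt0 sizeE hsimple tau_av).
by rewrite -(sum_clusters k_gt0 sizeE hsimple).
Qed.
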